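(* Let $S$ be a monotonically decreasing indexical set of agents. Let $P$ be a decision protocol that implements the knowledge-based program $\mathbf{P}(\Phi)$ with respect to an information exchange $\mathcal{E}$ and failure model $\mathcal{F}$, where $\Phi_{i,v}=B^S_i\,CB_S\,\exists v$. Then SBA($S$) is valid in $\mathcal{I}_{P,\mathcal{E},\mathcal{F}}$.
   Context: Agents $\mathrm{Agt}=\{1,\dots,n\}$; $V$ is a totally ordered set of decision values; actions $A_i=\{\mathtt{noop}\}\cup\{\mathtt{decide}_i(v):v\in V\}$. An information exchange $\mathcal{E}$ gives each agent $i$ a tuple $(L_i,I_i,M_i,\mu_i,\delta_i)$: local states $L_i$ of form $\langle\mathit{init}_i,\mathit{time}_i,\dots\rangle$ ($\mathit{init}_i\in V$ the initial preference), initial states $I_i$, messages $M_i\ni\bot$, $\mu_i:L_i\times A_i\to(\mathrm{Agt}\to M_i)$, $\delta_i:L_i\times A_i\times\prod_jM_j\to L_i$ (preserving $\mathit{init}_i$, incrementing $\mathit{time}_i$). A decision protocol is $P=(P_i:L_i\to A_i)_i$. A failure model $\mathcal{F}=(L^*_e,I_e,\delta_e,\mathit{Adv})$ has environment states, nonempty initial ones, update $\delta_e:L^*_e\times\prod_iA_i\to L^*_e$, and a nonempty set of adversaries $(\Delta^t,\Delta^r,\Delta^s)$ with $\Delta^t,\Delta^r:\mathbb{N}\times\mathrm{Agt}\times\mathrm{Agt}\times\bigcup_iM_i\to\bigcup_iM_i$, $\Delta^s_i:\mathbb{N}\times L_i\to L_i$ (not changing $\mathit{time}_i$). Runs $r$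 of $\mathcal{I}_{P,\mathcal{E},\mathcal{F}}$: $r(0)=((s_e,\alpha),s_1,\dots,s_n)$ with $s_e\in I_e,\alpha\in\mathit{Adv},s_i\in I_i$; from $r(k)=((s_e,\alpha),s_1,\dots,s_n)$, $r(k+1)=((\delta_e(s_e,(a_1,\dots,a_n)),\alpha),s'_1,\dots,s'_n)$ where $a_i=P_i(s_i)$ (action of $i$ at time $k$), $m_{i,j}=\mu_i(s_i,a_i)(j)$, $m'_{i,j}=\Delta^r(k,i,j,\Delta^t(k,i,j,m_{i,j}))$, $s^*_j=\delta_j(s_j,a_j,(m'_{1,j},\dots,m'_{n,j}))$, $s'_j=\Delta^s_j(k,s^*_j)$. $(r,m)\sim_i(r',m')$ iff $r_i(m)=r'_i(m')$; $K_i\phi$ holds iff $\phi$ holds at all $\sim_i$-related points. An indexical set $S$ assigns $S(r,m)\subseteq\mathrm{Agt}$ to each point; it is monotonically decreasing if $S(r,m)\subseteq S(r,m')$ whenever $m>m'$. $B^S_i\phi:=K_i(i\in S\Rightarrow\phi)$; $E^B_S\phi:=\bigwedge_{i\in S}B^S_i\phi$; $CB_S\phi:=\bigwedge_{k\ge1}(E^B_S)^k\phi$. $\exists v$ holds at $(r,m)$ iff some agent's initial preference in $r$ is $v$. The knowledge-based program $\mathbf{P}(\Phi)$ (for formulas $\Phi_{i,v}$) has agent $i$ do $\mathtt{noop}$ until some $v\in V$ satisfies $\Phi_{i,v}$, then perform $\mathtt{decide}_i(v)$ for the least such $v$, then $\mathtt{noop}$ forever. $P$ implements $\mathbf{P}(\Phi)$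 w.r.t. $\mathcal{E},\mathcal{F}$ if at every point $(r,m)$ of $\mathcal{I}_{P,\mathcal{E},\mathcal{F}}$ and every agent $i$, $P_i(r_i(m))$ is the action this program prescribes for $i$ at $(r,m)$, with $\Phi_{i,v}$ evaluated in $\mathcal{I}_{P,\mathcal{E},\mathcal{F}}$ (i.e. $\mathtt{noop}$ if $i$ performed a $\mathtt{decide}$ action at an earlier time in $r$; otherwise $\mathtt{decide}_i(v)$ for the least $v$ with $\Phi_{i,v}$ true at $(r,m)$ if one exists; otherwise $\mathtt{noop}$). SBA($S$) valid means in every run $r$: each agent performs a $\mathtt{decide}$ action at most once; if $i\in S(r,m)$ performs $\mathtt{decide}_i(v)$ at time $m$ then every $j\in S(r,m)$ performs $\mathtt{decide}_j(v)$ at time $m$; and if $i\in S(r,m)$ performs $\mathtt{decide}_i(v)$ at time $m$ then some agent has initial preference $v$. *)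

(* Defs.v *)
(* World: plain MathComp (boot + order).  Agents are 'I_n (i.e. {0..n-1},
   standing for {1..n}); decision values live in a totally ordered type V. *)
From mathcomp Require Import all_boot all_order.
Set Implicit Arguments.
Unset Strict Implicit.
Unset Printing Implicit Defensive.
Import Order.TTheory.
Local Open Scope order_scope.

Section Framework.
Variables (n : nat) (d : Order.disp_t) (V : orderType d).

Notation Agt := 'I_n.

(* Actions: noop or decide(v) (the agent index is implicit). *)
Inductive Action := noop | decide of V.

(* Information exchange E: for each agent i a tuple (L_i, I_i, M_i, mu_i, delta_i).
   Messages are taken in a common type Msg (the union of the M_i), with bot. *)
Record InfoExchange := {
  L : Agt -> Type;
  init : forall i, L i -> V;
  time : forall i, L i -> nat;
  Init : forall i, L i -> Prop;
  Msg : Type;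
  bot : Msg;
  mu : forall i, L i -> Action -> (Agt -> Msg);
  delta : forall i, L i -> Action -> (Agt -> Msg) -> L i;
  delta_init : forall i (s : L i) a ms, init (delta s a ms) = init s;
  delta_time : forall i (s : L i) a ms, time (delta s a ms) = (time s).+1
}.

Record Adversary (E : InfoExchange) := {
  Dt : nat -> Agt -> Agt -> Msg E -> Msg E;
  Dr : nat -> Agt -> Agt -> Msg E -> Msg E;
  Ds : forall i, nat -> L E i -> L E i;
  Ds_time : forall i k (s : L E i), time (Ds k s) = time s
}.

Record FailureModel (E : InfoExchange) := {
  Le : Type;
  Ie : Le -> Prop;
  Ie_nonempty : exists s, Ie s;
  deltae : Le -> (Agt -> Action) -> Le;
  Adv : Adversary E -> Prop;
  Adv_nonempty : exists a, Adv a
}.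

Definition Protocol (E : InfoExchange) := forall i, L E i -> Action.

Variables (E : InfoExchange) (F : FailureModel E).

Record GState := {
  genv : Le F;
  gadv : Adversary E;
  gloc : forall i, L E i
}.

Definition Run := nat -> GState.

Definition is_run (P : Protocol E) (r : Run) : Prop :=
  [/\ Ie (genv (r 0)), Adv F (gadv (r 0)), (forall i, Init (gloc (r 0) i))
    & forall k,
      let g := r k in
      let a := fun i => P i (gloc g i) in
      let al := gadv g in
      let m' := fun i j => Dr al k i j (Dt al k i j (mu (gloc g i) (a i) j)) in
      r k.+1 = {| genv := deltae (genv g) a;
                  gadv := al;
                  gloc := fun j => Ds al k (delta (gloc g j) (a j) (fun i => m' i j)) |}].

Definition formula := Run -> nat -> Prop.
Definition act (P : Protocol E) (r : Run) (m : nat) (i : Agt) : Action :=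
  P i (gloc (r m) i).

Definition K (P : Protocol E) (i : Agt) (phi : formula) : formula :=
  fun r m => forall r' m', is_run P r' -> gloc (r' m') i = gloc (r m) i -> phi r' m'.

Definition indexical := Run -> nat -> Agt -> Prop.

Definition mono_decreasing (P : Protocol E) (S : indexical) : Prop :=
  forall r, is_run P r -> forall m m' i, (m' < m)%N -> S r m i -> S r m' i.

Definition B (P : Protocol E) (S : indexical) (i : Agt) (phi : formula) : formula :=
  K P i (fun r m => S r m i -> phi r m).

Definition EB (P : Protocol E) (S : indexical) (phi : formula) : formula :=
  fun r m => forall i, S r m i -> B P S i phi r m.

Definition CB (P : Protocol E) (S : indexical) (phi : formula) : formula :=
  fun r m => forall k, (1 <= k)%N -> iter k (EB P S) phi r m.

Definition exists_val (v : V) : formula :=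
  fun r m => exists i, init (gloc (r 0) i) = v.

Definition implements (P : Protocol E) (Phi : Agt -> V -> formula) : Prop :=
  forall r, is_run P r -> forall m i,
    let decided_before :=
      exists m' v, (m' < m)%N /\ act P r m' i = decide v in
    (decided_before -> act P r m i = noop) /\
    (~ decided_before ->
       forall v, act P r m i = decide v <->
         (Phi i v r m /\ forall w, Phi i w r m -> v <= w)).

Definition SBA_valid (P : Protocol E) (S : indexical) : Prop :=
  forall r, is_run P r ->
    [/\ (forall i m1 m2 v1 v2,
           act P r m1 i = decide v1 -> act P r m2 i = decide v2 -> m1 = m2),
        (forall i m v, S r m i -> act P r m i = decide v ->
           forall j, S r m j -> act P r m j = decide v)
      & (forall i m v, S r m i -> act P r m i = decide v ->
           exists j, init (gloc (r 0) j) = v)].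

End Framework.

(* Main.v *)
(* For i in S, the belief B^S_i CB_S phi yields CB_S phi itself (knowledge is
   veridical and i is in S), and CB_S phi is a fixed point of E^B_S, so it
   yields B^S_j CB_S phi for every other j in S.  Hence at each point all
   members of S share the same set of values satisfying the decision
   condition, and pick the same least one.  Monotonicity of S is what
   guarantees that members of S at time m are still undecided together:
   an earlier decision of one of them would, by induction, have been taken
   simultaneously by all of them.  Validity follows from veridicality again,
   unfolding CB_S once. *)
Require Import Defs.
From mathcomp Require Import all_boot all_order.

Set Implicit Arguments.
Unset Strict Implicit.
Unset Printing Implicit Defensive.

Section Beliefs.
Variables (n : nat) (d : Order.disp_t) (V : orderType d).
Variables (E : InfoExchange n V) (F : FailureModel E) (P : Protocol E).
Variable S : indexical F.

Lemma K_veridical i (phi : formula F) r m :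
  is_run P r -> K P i phi r m -> phi r m.
Proof. by move=> run_r; apply. Qed.

Lemma B_veridical i (phi : formula F) r m :
  is_run P r -> S r m i -> B P S i phi r m -> phi r m.
Proof. by move=> run_r Si /(K_veridical run_r); apply. Qed.

Lemma CB_EB (phi : formula F) r m :
  CB P S phi r m -> EB P S (CB P S phi) r m.
Proof.
move=> CBphi j Sj r' m' run_r' eq_loc Sj' k _.
exact: (CBphi k.+1 isT j Sj r' m' run_r' eq_loc Sj').
Qed.

Lemma CB_veridical (phi : formula F) r m i :
  is_run P r -> S r m i -> CB P S phi r m -> phi r m.
Proof.
move=> run_r Si CBphi; have /= EBphi := CBphi 1 isT.
exact: B_veridical run_r Si (EBphi i Si).
Qed.

Lemma B_CB_shared (phi : formula F) r m i j :
  is_run P r -> S r m i -> S r m j ->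
  B P S i (CB P S phi) r m -> B P S j (CB P S phi) r m.
Proof. by move=> run_r Si Sj /(B_veridical run_r Si)/CB_EB; apply. Qed.

End Beliefs.

Section KnowledgeBasedProgram.
Variables (n : nat) (d : Order.disp_t) (V : orderType d).
Variables (E : InfoExchange n V) (F : FailureModel E) (P : Protocol E).
Variable Phi : 'I_n -> V -> formula F.
Hypothesis P_implements : implements P Phi.

Definition decided_before (r : Run F) m i :=
  exists m' v, (m' < m)%N /\ act P r m' i = decide v.

Variables (r : Run F) (run_r : is_run P r).

Lemma decide_undecided_before m i v :
  act P r m i = decide v -> ~ decided_before r m i.
Proof. by move=> dec_v /((P_implements run_r m i).1); rewrite dec_v. Qed.

Lemma decide_once i m1 m2 v1 v2 :
  act P r m1 i = decide v1 -> act P r m2 i = decide v2 -> m1 = m2.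
Proof.
move=> dec1 dec2; case: (ltngtP m1 m2) => // [lt12 | lt21].
- by case: (decide_undecided_before dec2); exists m1, v1.
- by case: (decide_undecided_before dec1); exists m2, v2.
Qed.

Lemma decideP m i v : ~ decided_before r m i ->
  act P r m i = decide v <-> Phi i v r m /\ forall w, Phi i w r m -> (v <= w)%O.
Proof. by move=> undec; have [_ /(_ undec v)] := P_implements run_r m i. Qed.

Lemma decide_Phi m i v : act P r m i = decide v -> Phi i v r m.
Proof.
by move=> dec_v; case: ((decideP v (decide_undecided_before dec_v)).1 dec_v).
Qed.

Variable S : indexical F.
Hypothesis S_mono : mono_decreasing P S.
Hypothesis Phi_shared : forall m i j v,
  S r m i -> S r m j -> Phi i v r m -> Phi j v r m.

Lemma decide_agreement i m v : S r m i -> act P r m i = decide v ->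
  forall j, S r m j -> act P r m j = decide v.
Proof.
elim/ltn_ind: m i v => m IH i v Si dec_i j Sj.
have undec_i := decide_undecided_before dec_i.
have [Phi_i min_i] := (decideP v undec_i).1 dec_i.
have undec_j : ~ decided_before r m j.
  move=> [m' [w [lt_m'm dec_j]]].
  have dec_i' := IH m' lt_m'm j w (S_mono run_r lt_m'm Sj) dec_j i
                   (S_mono run_r lt_m'm Si).
  by move: lt_m'm; rewrite (decide_once dec_i' dec_i) ltnn.
apply/(decideP v undec_j); split; first exact: Phi_shared Phi_i.
by move=> w Phi_j_w; apply/min_i/(Phi_shared Sj Si).
Qed.

End KnowledgeBasedProgram.

Theorem proposition8 (n : nat) (d : Order.disp_t) (V : orderType d)
  (E : InfoExchange n V) (F : FailureModel E) (P : Protocol E)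
  (S : indexical F) :
  mono_decreasing P S ->
  implements P (fun i v => B P S i (CB P S (@exists_val n d V E F v))) ->
  SBA_valid P S.
Proof.
move=> S_mono P_impl r run_r.
have once := decide_once P_impl run_r.
have agree := decide_agreement P_impl run_r S_mono.
split => //.
- apply: agree => m i j v Si Sj.
  exact: B_CB_shared run_r Si Sj.
- move=> i m v Si /(decide_Phi P_impl run_r) Phi_i.
  exact: CB_veridical run_r Si (B_veridical run_r Si Phi_i).
Qed.
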